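(* Assume that (i) for every $j\in\{1,\dots,K\}$ and all $1\le \tau\le\tau'$, $\max_i p_{ji}^{(\tau)}\ge \max_i p_{ji}^{(\tau')}$, and (ii) $R^1<\infty$ and $R^1\ge R(\vec\pi_j^{\tau},0)\ge R(\vec\pi_j^{\tau'},0)$ for all $j$ and all $1\le\tau\le\tau'$. Let $W$ be fixed. Then there exist $\Gamma_1,\dots,\Gamma_K\in\{0,1,\ldots\}$ such that the threshold policy $\vec\Gamma=(\Gamma_1,\dots,\Gamma_K)$ is an optimal solution, for all $0\le\beta<1$, of the single-user $\beta$-discounted problem: maximize over policies $\phi$ $$\liminf_{T\to\infty}\frac{1}{\sum_{t=1}^T\beta^{t-1}}\,\mathbb{E}\Big(\sum_{t=1}^T\beta^{t-1}\big(r(\vec b^\phi(t),a^\phi(t))+W(1-a^\phi(t))\big)\Big)$$ in the approximating controlled Markov chain described in the context.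
   Context: Single-user model. Let $P=(p_{ij})_{i,j\in\{1,\dots,K\}}$ be a stochastic matrix (transition matrix of the user's channel with states $h_1,\dots,h_K$), with $\tau$-step probabilities $p_{ij}^{(\tau)}=(P^\tau)_{ij}$ and steady-state distribution $(p_1^s,\dots,p_K^s)$ (assumed to exist). For $j\in\{1,\dots,K\}$ and integer $\tau\ge1$ the belief state $\vec\pi_j^\tau=\vec e_jP^\tau=(p_{j1}^{(\tau)},\dots,p_{jK}^{(\tau)})$, where $\vec e_j$ is the $j$-th unit row vector, means that the user was last observed $\tau$ slots ago in channel state $h_j$; belief states are labelled by the pairs $(j,\tau)$. In each slot an action $a\in\{0,1\}$ is chosen ($a=1$ active: a pilot is allocated; $a=0$ passive). The average immediate reward is $r(\vec\pi_j^\tau,1)=R^1$ and $r(\vec\pi_j^\tau,0)=R(\vec\pi_j^\tau,0)$; rewards are throughputs, so they are nonnegative. $W$ is the subsidy for passivity. Approximating transition law: under $a=0$, $\vec\pi_j^\tau$ moves to $\vec\pi_j^{\tau+1}$ with probability 1; under $a=1$, $\vec\pi_j^\tau$ moves to $\vec\pi_k^1$ with probability $p_k^s$, $k=1,\dots,K$. $\vec b^\phi(t)$ and $a^\phi(t)$ denote belief state and action at slot $t$ under policy $\phi$. The corresponding Bellman equation is $$V_\beta(\vec\pi_j^\tau)=\max\Big\{R(\vec\pi_j^\tau,0)+W+\beta V_\beta(\vec\pi_j^{\tau+1});\ R^1+\beta\sum_{k=1}^Kp_k^sV_\beta(\vec\pi_k^1)\Big\}.$$ Threshold policy $\vec\Gamma=(\Gamma_1,\dots,\Gamma_K)$: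 choose $a=0$ in $\vec\pi_j^\tau$ if $\tau\le\Gamma_j$ and $a=1$ if $\tau>\Gamma_j$.
   Formalization: The thresholds may depend on β (for every 0≤β<1 there exist Γ_1,…,Γ_K), and each Γ_j ranges over {0,1,…}∪{∞}, where ∞ means never activating; with finite thresholds, or one Γ for all β, the claim is false. *)

(* Defs.v *)
From mathcomp Require Import all_boot all_order all_algebra.
From mathcomp Require Import all_classical all_reals all_analysis.

Set Implicit Arguments.
Unset Strict Implicit.
Unset Printing Implicit Defensive.

Import Order.TTheory GRing.Theory Num.Theory.
Local Open Scope ring_scope.

Definition stochastic_mx (R : realType) (K : nat) (P : 'M[R]_K) : Prop :=
  (forall i j, 0 <= P i j) /\ (forall i, \sum_j P i j = 1).

(* [ps 0 k] is p_k^s.  The conditions force K > 0, and they hold in particular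
   for the common limit of the rows of P ^+ tau, when that limit exists. *)
Definition steady_state (R : realType) (K : nat) (P : 'M[R]_K)
    (ps : 'rV[R]_K) : Prop :=
  [/\ forall k, 0 <= ps 0 k, \sum_k ps 0 k = 1 & ps *m P = ps].

Definition belief (R : realType) (K : nat) (P : 'M[R]_K) (j : 'I_K)
    (tau : nat) : 'rV[R]_K :=
  delta_mx 0 j *m P ^+ tau.

(* The pair (j, tau) labels the belief state pi_j^tau.  Only labels with
   tau >= 1 are belief states; labels with tau = 0 are never reached from
   them. *)
Definition state (K : nat) : Type := ('I_K * nat)%type.

(* Actions are booleans: [true] is a = 1 (active), [false] is a = 0 (passive). *)
Definition reward (R : realType) (K : nat) (r1 : R) (r0 : 'rV[R]_K -> R)
    (pi : 'rV[R]_K) (a : bool) : R :=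
  if a then r1 else r0 pi.

(* Past belief states and actions, oldest first: the entry at index t is the
   pair of the belief state and the action of slot t + 1. *)
Definition history (K : nat) : Type := seq (state K * bool).

(* History-dependent randomized policies: [active_prob phi h s] is the
   probability of choosing a = 1 in state s after the history h.  The slot
   number is [(size h).+1], so policies may also depend on time. *)
Record policy (R : realType) (K : nat) := Policy {
  active_prob : history K -> state K -> R;
  active_probP : forall h s, 0 <= active_prob h s <= 1 }.

Definition action_prob (R : realType) (K : nat) (phi : policy R K)
    (h : history K) (s : state K) (a : bool) : R :=
  if a then active_prob phi h s else 1 - active_prob phi h s.

(* Expectation of f under the one-slot transition law from s under action a. *)
Definition next_expect (R : realType) (K : nat) (ps : 'rV[R]_K) (s : state K)
    (a : bool) (f : state K -> R) : R :=
  if a then \sum_(k < K) ps 0 k * f (k, 1%N) else f (s.1, s.2.+1).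

(* Expectation of [f (h ++ g)], where g is the random sequence of the states
   and actions of the n slots following the history h, the first of these
   slots being spent in state s.  The law of g has finite support: it is the
   composition of the action probabilities of phi with the transition law. *)
Fixpoint traj_expect (R : realType) (K : nat) (ps : 'rV[R]_K)
    (phi : policy R K) (n : nat) (h : history K) (s : state K)
    (f : history K -> R) {struct n} : R :=
  if n is n'.+1 then
    \sum_(a : bool) action_prob phi h s a *
      next_expect ps s a
        (fun s' => traj_expect ps phi n' (rcons h (s, a)) s' f)
  else f h.

(* Discounted reward of a trajectory, including the subsidy W for passivity;
   the entry at index t is slot t + 1, hence the weight beta ^+ t. *)
Definition discounted_reward (R : realType) (K : nat) (P : 'M[R]_K) (r1 : R)
    (r0 : 'rV[R]_K -> R) (W beta : R) (g : history K) : R :=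
  \sum_(t < size g)
    (let: (s, a) := tnth (in_tuple g) t in
     beta ^+ t * (reward r1 r0 (belief P s.1 s.2) a + W * (1 - a%:R))).

Definition discounted_value (R : realType) (K : nat) (P : 'M[R]_K)
    (ps : 'rV[R]_K) (r1 : R) (r0 : 'rV[R]_K -> R) (W beta : R)
    (phi : policy R K) (s : state K) : \bar R :=
  limn_einf (fun T : nat =>
    ((\sum_(1 <= t < T.+1) beta ^+ t.-1)^-1 *
     traj_expect ps phi T [::] s (discounted_reward P r1 r0 W beta))%:E).

Definition optimal (R : realType) (K : nat) (P : 'M[R]_K) (ps : 'rV[R]_K)
    (r1 : R) (r0 : 'rV[R]_K -> R) (W beta : R) (phi : policy R K) : Prop :=
  forall (j : 'I_K) (tau : nat), (1 <= tau)%N -> forall psi : policy R K,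
    (discounted_value P ps r1 r0 W beta psi (j, tau) <=
     discounted_value P ps r1 r0 W beta phi (j, tau))%E.

(* A threshold is an element of {0, 1, ...} with +oo added: [Some n] is n and
   [None] is +oo, for which a = 0 is chosen at every tau. *)
Definition threshold_active (K : nat) (Gamma : 'I_K -> option nat)
    (s : state K) : bool :=
  if Gamma s.1 is Some n then (n < s.2)%N else false.

Lemma threshold_activeP (R : realType) (K : nat) (Gamma : 'I_K -> option nat)
    (h : history K) (s : state K) :
  0 <= ((threshold_active Gamma s)%:R : R) <= 1.
Proof. by case: threshold_active; rewrite ?lexx ler01. Qed.

Definition threshold_policy (R : realType) (K : nat)
    (Gamma : 'I_K -> option nat) : policy R K :=
  Policy (@threshold_activeP R K Gamma).

(* Main.v *)
Require Import Defs.
From mathcomp Require Import all_boot all_order all_algebra.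
From mathcomp Require Import all_classical all_reals all_analysis.
From mathcomp Require Import ring lra.

(** The active action has the same value [A] in every belief state, because its
    reward [r1] and the law of the next state do not depend on the current one.
    The control problem is therefore an optimal stopping problem: from
    [(j, tau)], decide how long to stay passive before collecting [A].  Write
    [w (j, tau)] for the passive reward plus the subsidy and [c = (1 - beta) A]
    for the reward per slot that is worth as much as [A].  Being passive for one
    more slot before activating gains [w - c] over activating at once, and [w]
    is nonincreasing in [tau], so the gains that are worth taking come first:
    one should stay passive exactly as long as [w > c].  This is a threshold
    rule, whose threshold for [j] is infinite when [w (j, tau)] stays above
    [c].

    The argument also gives the value function explicitly:
    [V (j, tau) = A + \sum_m beta ^+ m * (w (j, tau + m) - c)^+], whose series
    is [excess].  It satisfies the Bellman equation for the passive action
    because [excess] loses its first term when [tau] grows by one ([excessS]),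
    and that term is the positive part of [w - c].  The Bellman equation for the
    active action reads [c = r1 + beta * \sum_k p_k * excess c (k, 1)], an
    equation in the single real unknown [c].  Its right-hand side is Lipschitz
    in [c] ([excess_lipschitz]), at least [r1], and equal to [r1] once [c] is
    above all values of [w], so the intermediate value theorem solves it
    ([lipschitz_fixpoint]).

    A bounded solution of the Bellman equation bounds the [T]-slot reward of
    every policy up to an error of order [beta ^+ T], in both directions for
    a policy that plays optimal actions ([traj_expect_le]).  The error
    disappears in the limit inferior, which gives [optimal_of_bellman]. *)

Set Implicit Arguments.
Unset Strict Implicit.
Unset Printing Implicit Defensive.

Import Order.TTheory GRing.Theory Num.Theory.
Import numFieldNormedType.Exports.
Local Open Scope ring_scope.

(** * Discounted series *)

Definition discounted_sum (R : realType) (beta : R) (u : nat -> R) : R :=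
  limn (series (fun m => beta ^+ m * u m)).

Section DiscountedSum.
Context (R : realType) (beta : R).
Hypotheses (beta_ge0 : 0 <= beta) (beta_lt1 : beta < 1).
Implicit Types (u v : nat -> R) (e : R).

Let beta_norm : `|beta| < 1.
Proof. by rewrite ger0_norm. Qed.

Lemma is_cvg_discounted u e : (forall m, `|u m| <= e) ->
  cvgn (series (fun m => beta ^+ m * u m)).
Proof.
move=> ue; apply: normed_cvg.
apply: (@series_le_cvg _ _ (geometric e beta)) => [n|n|n|] //=.
- by rewrite mulr_ge0 ?exprn_ge0// (le_trans _ (ue 0%N)).
- by rewrite normrM ger0_norm ?exprn_ge0// mulrC ler_wpM2r ?exprn_ge0.
- exact: is_cvg_geometric_series.
Qed.

Lemma discounted_sum_ge0 u e : (forall m, `|u m| <= e) ->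
  (forall m, 0 <= u m) -> 0 <= discounted_sum beta u.
Proof.
move=> ue u0; apply: limr_ge; first exact: is_cvg_discounted ue.
by apply: nearW => n; apply: sumr_ge0 => i _; rewrite mulr_ge0 ?exprn_ge0.
Qed.

Lemma discounted_sum0 u : (forall m, u m = 0) -> discounted_sum beta u = 0.
Proof.
move=> u0; apply/cvg_lim => //.
rewrite (_ : series _ = cst 0); first exact: cvg_cst.
by apply/funext => n; rewrite /series /= big1// => i _; rewrite u0 mulr0.
Qed.

Lemma discounted_sumS u e : (forall m, `|u m| <= e) ->
  discounted_sum beta u = u 0%N + beta * discounted_sum beta (u \o S).
Proof.
move=> ue; apply/cvg_lim => //; rewrite -(cvg_shiftn 1).
have cS := @is_cvg_discounted (u \o S) e (fun m => ue m.+1).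
rewrite (_ : (fun n => _) =
  (fun n => u 0%N + beta * series (fun m => beta ^+ m * (u \o S) m) n)).
  by apply: cvgD; [exact: cvg_cst | apply: cvgM; [exact: cvg_cst | exact: cS]].
apply/funext => n; rewrite addn1 /series /= big_nat_recl// expr0 mul1r.
rewrite mulr_sumr; congr (_ + _); apply: eq_bigr => i _.
by rewrite exprS mulrA.
Qed.

Lemma discounted_sum_dist u v (M : R) e : (forall m, `|u m| <= M) ->
  (forall m, `|v m| <= M) -> (forall m, `|u m - v m| <= e) ->
  `|discounted_sum beta u - discounted_sum beta v| <= (1 - beta)^-1 * e.
Proof.
move=> uM vM uve.
have cu := is_cvg_discounted uM; have cv := is_cvg_discounted vM.
have ge := @cvg_geometric_series _ e beta beta_norm.
rewrite mulrC; apply: (ler_cvg_to (cvg_norm (cvgB cu cv)) ge).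
apply: nearW => n /=; rewrite !seriesEnat /= fctE -sumrB.
apply: (le_trans (ler_norm_sum _ _ _)); apply: ler_sum => i _.
by rewrite -mulrBr normrM ger0_norm ?exprn_ge0// mulrC ler_wpM2r ?exprn_ge0.
Qed.

End DiscountedSum.

(** * Two facts of real analysis *)

(** [L] is arbitrary, so this is not the contraction principle: at [a] the graph
    of [F] is above the diagonal, at [b] below it, and it crosses in between. *)
Lemma lipschitz_fixpoint (R : realType) (F : R -> R) (L a b : R) :
  (forall x y, `|F x - F y| <= L * `|x - y|) ->
  a <= b -> a <= F a -> F b <= b -> exists c, F c = c.
Proof.
move=> FL ab aFa Fbb.
have cF : continuous F.
  move=> x; apply/cvgrPdist_le => e e0; near=> y.
  apply: (le_trans (FL x y)).
  apply: (@le_trans _ _ ((`|L| + 1) * `|x - y|)).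
    by rewrite ler_wpM2r// (le_trans (ler_norm L))// lerDl.
  have L1 : 0 < `|L| + 1 by rewrite ltr_wpDl.
  rewrite mulrC -ler_pdivlMr//; near: y.
  have /cvgrPdist_le := @cvg_id _ (nbhs x); apply; rewrite divr_gt0//.
have [||c _ /eqP] := @IVT R (fun x => F x - x) a b 0 ab.
- by apply: continuous_subspaceT => x; apply: cvgB; [exact: cF | exact: cvg_id].
- by rewrite ge_min !subr_le0 Fbb orbT /= le_max !subr_ge0 aFa.
- by rewrite subr_eq0 => /eqP; exists c.
Unshelve. all: by end_near. Qed.

(** The comparison needs only an inequality that holds up to an error tending
    to 0; this is how the tails of the discounted rewards are discarded. *)
Lemma le_limn_einf (R : realType) (u v : (\bar R)^nat) :
  (forall e : R, 0 < e -> \forall n \near \oo%classic, (u n <= e%:E + v n)%E) ->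
  (limn_einf u <= limn_einf v)%E.
Proof.
move=> uv; apply/lee_addgt0Pr => e e0; rewrite addeC -limn_einf_shift//.
rewrite !limn_einf_lim; apply: lee_lim; [exact: is_cvg_einfs.. |].
have [N _ uvN] := uv e e0; exists N => // n /= Nn.
apply: le_ereal_inf_tmp => _ [k /= nk <-].
apply: le_trans (uvN k _); last exact: leq_trans nk.
by apply: ereal_inf_lbound; exists k.
Qed.

(** * Verification by a solution of the Bellman equation *)

Section Verification.
Context (R : realType) (K : nat) (P : 'M[R]_K) (ps : 'rV[R]_K).
Context (r1 : R) (r0 : 'rV[R]_K -> R) (W beta : R).
Hypotheses (ps_ge0 : forall k, 0 <= ps 0 k) (ps_sum : \sum_k ps 0 k = 1).
Hypothesis beta_ge0 : 0 <= beta.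
Implicit Types (h : history K) (s : state K) (a : bool) (phi : policy R K).

Let D := discounted_reward P r1 r0 W beta.

Definition slot_reward s a : R :=
  reward r1 r0 (belief P s.1 s.2) a + W * (1 - a%:R).

Definition action_value (V : state K -> R) s a : R :=
  slot_reward s a + beta * next_expect ps s a V.

Lemma discounted_reward_rcons h s a :
  D (rcons h (s, a)) = D h + beta ^+ size h * slot_reward s a.
Proof.
have DE g : D g = \sum_(t < size g)
    beta ^+ t * slot_reward (nth (s, a) g t).1 (nth (s, a) g t).2.
  rewrite /D /discounted_reward; apply: eq_bigr => t _.
  by rewrite (tnth_nth (s, a)) /=; case: nth.
rewrite !DE size_rcons big_ord_recr /= nth_rcons ltnn eqxx; congr (_ + _).
by apply: eq_bigr => t _; rewrite nth_rcons ltn_ord.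
Qed.

Lemma action_prob_ge0 phi h s a : 0 <= action_prob phi h s a.
Proof.
have /andP[] := active_probP phi h s.
by case: a => //= _; rewrite subr_ge0.
Qed.

Lemma sum_action_prob phi h s : \sum_a action_prob phi h s a = 1.
Proof. by rewrite big_bool /= addrC subrK. Qed.

(** The transition law is a probability, so an affine inequality between
    functions passes to expectations with its constants unchanged.  Only labels
    with a positive second component are ever reached, hence the restriction
    on [s']. *)
Lemma next_expect_le (e x y z : R) (f V : state K -> R) s a :
  (forall s', (0 < s'.2)%N -> e * f s' <= e * (x + y * V s') + z) ->
  e * next_expect ps s a f <= e * (x + y * next_expect ps s a V) + z.
Proof.
move=> fV; case: a => /=; last exact: fV.
have -> : e * (x + y * \sum_k ps 0 k * V (k, 1%N)) + z =
    \sum_k ps 0 k * (e * (x + y * V (k, 1%N)) + z).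
  rewrite [RHS](eq_bigr (fun k => ps 0 k * (e * x + z) +
    e * y * (ps 0 k * V (k, 1%N)))); last by move=> k _; ring.
  by rewrite big_split /= -mulr_suml ps_sum -mulr_sumr; ring.
rewrite mulr_sumr; apply: ler_sum => k _.
by rewrite mulrCA ler_wpM2l// fV.
Qed.

(** One induction on the horizon serves for both directions.  With [e = 1], the
    hypothesis says that no action that [phi] may choose has a value above [V],
    and the reward of [phi] is bounded above by [V]; with [e = -1] both
    inequalities are reversed.  The weight [action_prob phi h s a] in the
    hypothesis restricts it to the actions that [phi] does choose.  The
    remainder [beta ^+ (size h + n) * B] pays for cutting the sum after [n]
    slots, where [V] would count all later rewards. *)
Lemma traj_expect_le (V : state K -> R) (B e : R) phi :
  (forall s, (0 < s.2)%N -> 0 <= e * V s + B) ->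
  (forall h s a, (0 < s.2)%N ->
     action_prob phi h s a * (e * action_value V s a) <=
     action_prob phi h s a * (e * V s)) ->
  forall n h s, (0 < s.2)%N ->
    e * traj_expect ps phi n h s D <=
    e * (D h + beta ^+ size h * V s) + beta ^+ (size h + n) * B.
Proof.
move=> VB Vopt; elim=> [|n IH] h s s0 /=.
  rewrite addn0 mulrDr -addrA lerDl mulrCA -mulrDr.
  by rewrite mulr_ge0 ?exprn_ge0 ?VB.
set X := (X in _ <= X).
rewrite -[leRHS]mul1r -(sum_action_prob phi h s) mulr_suml mulr_sumr.
apply: ler_sum => a _; rewrite mulrCA.
have pa0 := action_prob_ge0 phi h s a.
apply: (@le_trans _ _ (action_prob phi h s a * (e *
   (D h + beta ^+ size h * action_value V s a) + beta ^+ (size h + n.+1) * B))).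
  rewrite ler_wpM2l//.
  have /le_trans := next_expect_le s a (fun s' => IH (rcons h (s, a)) s').
  apply.
  rewrite discounted_reward_rcons size_rcons /action_value addSnnS.
  by rewrite exprS le_eqVlt; apply/orP; left; apply/eqP; ring.
have := ler_wpM2l (exprn_ge0 (size h) beta_ge0) (Vopt h s a s0).
rewrite /X; lra.
Qed.

End Verification.

(** Over [T] slots, [psi] earns at most [V + beta ^+ T * B] and [phi] at least
    [V - beta ^+ T * B]; normalizing does not enlarge the difference, because
    the sum of the weights is at least 1. *)
Lemma optimal_of_bellman (R : realType) (K : nat) (P : 'M[R]_K)
    (ps : 'rV[R]_K) (r1 : R) (r0 : 'rV[R]_K -> R) (W beta : R)
    (V : state K -> R) (B : R) (phi : policy R K) :
  (forall k, 0 <= ps 0 k) -> \sum_k ps 0 k = 1 -> 0 <= beta -> beta < 1 ->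
  (forall s, (0 < s.2)%N -> `|V s| <= B) ->
  (forall s a, (0 < s.2)%N -> action_value P ps r1 r0 W beta V s a <= V s) ->
  (forall h s a, (0 < s.2)%N -> action_prob phi h s a != 0 ->
     action_value P ps r1 r0 W beta V s a = V s) ->
  optimal P ps r1 r0 W beta phi.
Proof.
move=> ps_ge0 ps_sum beta_ge0 beta_lt1 VB V_super V_phi j tau tau0 psi.
have B0 : 0 <= B by apply: le_trans (VB (j, tau) tau0).
have upper := traj_expect_le ps_ge0 ps_sum beta_ge0 (V := V) (B := B) (e := 1)
  (phi := psi) (P := P) (r1 := r1) (r0 := r0) (W := W).
have lower := traj_expect_le ps_ge0 ps_sum beta_ge0 (V := V) (B := B) (e := -1)
  (phi := phi) (P := P) (r1 := r1) (r0 := r0) (W := W).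
apply: le_limn_einf => e e0.
have tail : \forall T \near \oo%classic, 2 * B * beta ^+ T <= e.
  have beta_norm : `|beta| < 1 by rewrite ger0_norm.
  have /cvgrPdist_le/(_ e e0) := @cvg_geometric _ (2 * B) beta beta_norm.
  apply: filterS => T; rewrite sub0r normrN; apply: le_trans.
  exact: ler_norm.
apply: filterS tail => T tailT.
rewrite -EFinD lee_fin.
set S := \sum_(1 <= t < T.+1) _.
have [S0 S1] : 0 <= S^-1 /\ S^-1 <= 1.
  (* for T = 0 the empty sum has inverse 0 *)
  case: {+}T @S => [|T'] S; first by rewrite /S big_geq// invr0.
  have S1 : 1 <= S.
    rewrite /S big_ltn//= expr0 lerDl big_nat.
    by apply: sumr_ge0 => t _; rewrite exprn_ge0.
  by rewrite invr_ge0 invf_le1 ?(le_trans ler01)// (lt_le_trans ltr01).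
have D0 : discounted_reward P r1 r0 W beta [::] = 0 :> R.
  by rewrite /discounted_reward big_ord0.
have {}upper : traj_expect ps psi T [::] (j, tau)
    (discounted_reward P r1 r0 W beta) <= V (j, tau) + beta ^+ T * B.
  have := upper _ _ T [::] (j, tau) tau0.
  rewrite /= add0n D0 add0r expr0 !mul1r; apply => [s s0|h s a s0].
    by rewrite mul1r; have := VB s s0; rewrite ler_norml; lra.
  by rewrite !mul1r ler_wpM2l ?V_super// action_prob_ge0.
have {}lower : V (j, tau) - beta ^+ T * B <= traj_expect ps phi T [::] (j, tau)
    (discounted_reward P r1 r0 W beta).
  have : (-1) * traj_expect ps phi T [::] (j, tau)
      (discounted_reward P r1 r0 W beta) <=
      (-1) * (0 + beta ^+ 0 * V (j, tau)) + beta ^+ (0 + T) * B; last first.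
    by rewrite expr0; lra.
  rewrite -D0; apply: lower => // [s s0|h s a s0].
    by have := VB s s0; rewrite ler_norml; lra.
  have [->|p0] := eqVneq (action_prob phi h s a) 0; first by rewrite !mul0r.
  by rewrite (V_phi h s a s0 p0).
have diff : traj_expect ps psi T [::] (j, tau)
    (discounted_reward P r1 r0 W beta) <= traj_expect ps phi T [::] (j, tau)
    (discounted_reward P r1 r0 W beta) + 2 * B * beta ^+ T by lra.
apply: (le_trans (ler_wpM2l S0 diff)); rewrite mulrDr addrC lerD2r.
apply: le_trans tailT; rewrite -[leRHS]mul1r ler_wpM2r//.
by rewrite !mulr_ge0 ?exprn_ge0.
Qed.

(** * Optimal stopping with nonincreasing rewards *)

Section Excess.
Context (R : realType) (K : nat) (beta : R) (w : state K -> R) (M : R).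
Hypotheses (beta_ge0 : 0 <= beta) (beta_lt1 : beta < 1).
Hypothesis w_bounded : forall s, (0 < s.2)%N -> `|w s| <= M.
Hypothesis w_noninc : forall j tau tau', (0 < tau <= tau')%N ->
  w (j, tau') <= w (j, tau).
Implicit Types (s : state K) (x y : R).

(** What is gained, over stopping at once and earning [x] per slot from then on,
    by first collecting [w] for as long as it exceeds [x].  For nonincreasing
    [w] the positive terms come first, so the positive parts give the best
    stopping time. *)
Definition excess x s : R :=
  discounted_sum beta (fun m => Num.max (w (s.1, s.2 + m)%N - x) 0).

Lemma excess_term_le x s m : (0 < s.2)%N ->
  `|Num.max (w (s.1, s.2 + m)%N - x) 0| <= M + `|x|.
Proof.
move=> s0; have wM := w_bounded (s := (s.1, s.2 + m)%N) (ltn_addr m s0).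
rewrite ger0_norm ?le_max ?lexx ?orbT// ge_max.
rewrite addr_ge0 ?(le_trans _ wM)// andbT.
by rewrite (le_trans (ler_norm _))// (le_trans (ler_normB _ _))// lerD2r.
Qed.

Lemma excess_ge0 x s : (0 < s.2)%N -> 0 <= excess x s.
Proof.
move=> s0; apply: (discounted_sum_ge0 beta_ge0 beta_lt1) => m.
  exact: excess_term_le.
by rewrite le_max lexx orbT.
Qed.

Lemma excessS x s : (0 < s.2)%N ->
  excess x s = Num.max (w s - x) 0 + beta * excess x (s.1, s.2.+1).
Proof.
move=> s0; rewrite /excess (discounted_sumS beta_ge0 beta_lt1
  (fun m => excess_term_le x m s0)) addn0 -surjective_pairing.
congr (_ + _ * discounted_sum _ _).
by apply/funext => m /=; rewrite addnS.
Qed.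

(** Monotonicity makes stopping final: once [w] is at most [x], it never pays
    again to go on. *)
Lemma excess_eq0 x s : (0 < s.2)%N -> w s <= x -> excess x s = 0.
Proof.
case: s => j tau /= t0 wx; apply: discounted_sum0 => m; apply: max_r.
by rewrite subr_le0 (le_trans _ wx)// w_noninc// t0 leq_addr.
Qed.

Lemma excess_le x s : (0 < s.2)%N -> excess x s <= (1 - beta)^-1 * (M + `|x|).
Proof.
move=> s0; rewrite (le_trans (ler_norm _))//.
have M0 : 0 <= M + `|x| by apply: le_trans (excess_term_le x 0 s0).
have := discounted_sum_dist beta_ge0 beta_lt1 (v := fun=> 0) (M := M + `|x|)
  (e := M + `|x|) (fun m => excess_term_le x m s0).
rewrite (discounted_sum0 _ (u := fun=> 0))// subr0; apply=> m.
  by rewrite normr0.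
by rewrite subr0; exact: excess_term_le.
Qed.

Lemma excess_lipschitz s x y : (0 < s.2)%N ->
  `|excess x s - excess y s| <= (1 - beta)^-1 * `|x - y|.
Proof.
move=> s0; apply: (discounted_sum_dist beta_ge0 beta_lt1
  (M := M + `|x| + `|y|)) => m.
- by rewrite (le_trans (excess_term_le _ _ s0))// lerDl.
- by rewrite (le_trans (excess_term_le _ _ s0))// lerD2r lerDl.
- set z := w _.
  rewrite !maxEle; case: (leP (z - x)); case: (leP (z - y)) => zy zx.
  all: rewrite ler_norml; apply/andP; have := ler_norm (x - y).
  all: have := ler_norm (y - x); rewrite [`|y - x|]distrC; split; lra.
Qed.

End Excess.

(** Since [w (j, _)] is nonincreasing, the labels with [w <= c] form a final
    segment, empty when the threshold is [None]. *)
Lemma threshold_of_noninc (R : realType) (K : nat) (w : state K -> R) (c : R) :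
  (forall j tau tau', (0 < tau <= tau')%N -> w (j, tau') <= w (j, tau)) ->
  exists Gamma : 'I_K -> option nat, forall s, (0 < s.2)%N ->
    threshold_active Gamma s = (w s <= c).
Proof.
move=> w_noninc.
suff /choice[Gamma GammaP] : forall j : 'I_K, exists g : option nat,
    forall tau, (0 < tau)%N ->
      (if g is Some n then (n < tau)%N else false) = (w (j, tau) <= c).
  by exists Gamma => -[j tau] t0; exact: GammaP.
move=> j; have [ex|none] := pselect (exists n, w (j, n.+1) <= c); last first.
  exists None => -[//|tau] _; apply/esym/negbTE/negP => wc.
  by apply: none; exists tau.
exists (Some (ex_minn ex)); case: ex_minnP => n wn n_min [//|tau] _.
rewrite ltnS; apply/idP/idP => [ntau|]; last exact: n_min.
by apply: le_trans wn; apply: w_noninc.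
Qed.

Theorem theorem1 (R : realType) (K : nat) (P : 'M[R]_K) (ps : 'rV[R]_K)
    (r1 : R) (r0 : 'rV[R]_K -> R)
    (P_stochastic : stochastic_mx P) (ps_steady : steady_state P ps)
    (r1_ge0 : 0 <= r1)
    (r0_ge0 : forall (j : 'I_K) (tau : nat),
       (1 <= tau)%N -> 0 <= r0 (belief P j tau))
    (max_noninc : forall (j : 'I_K) (tau tau' : nat), (1 <= tau <= tau')%N ->
       \big[Num.max/0]_(i < K) (P ^+ tau') j i <=
       \big[Num.max/0]_(i < K) (P ^+ tau) j i)
    (r0_noninc : forall (j : 'I_K) (tau tau' : nat), (1 <= tau <= tau')%N ->
       r0 (belief P j tau') <= r0 (belief P j tau) <= r1)
    (W : R) (beta : R) (beta_ge0 : 0 <= beta) (beta_lt1 : beta < 1) :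
  exists Gamma : 'I_K -> option nat,
    optimal P ps r1 r0 W beta (threshold_policy R Gamma).
Proof.
pose w (s : state K) := r0 (belief P s.1 s.2) + W.
pose M := r1 + `|W|.
have [ps_ge0 ps_sum _] := ps_steady.
have w_noninc j tau tau' : (0 < tau <= tau')%N -> w (j, tau') <= w (j, tau).
  by move=> tt; rewrite /w lerD2r; case/andP: (r0_noninc j tau tau' tt).
have w_bounded s : (0 < s.2)%N -> `|w s| <= M.
  move=> s0; apply: (le_trans (ler_normD _ _)); rewrite lerD2r.
  rewrite ger0_norm ?r0_ge0//.
  by have /andP[] := r0_noninc s.1 s.2 s.2 (introT andP (conj s0 (leqnn _))).
(* The Bellman equation of the active action, solved for c. *)
have [c cE] : exists c,
    r1 + beta * (\sum_k ps 0 k * excess beta w c (k, 1%N)) = c.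
  apply: (@lipschitz_fixpoint _ _ (beta * (1 - beta)^-1) r1 M).
  - move=> x y; rewrite opprD addrACA subrr add0r -mulrBr normrM.
    rewrite (ger0_norm beta_ge0) -mulrA ler_wpM2l// -sumrB.
    rewrite -[leRHS]mul1r -[X in _ <= X * _]ps_sum mulr_suml.
    apply: (le_trans (ler_norm_sum _ _ _)); apply: ler_sum => k _.
    rewrite -mulrBr normrM (ger0_norm (ps_ge0 k)) ler_wpM2l//.
    exact: (excess_lipschitz beta_ge0 beta_lt1 w_bounded).
  - by rewrite /M lerDl.
  - rewrite lerDl mulr_ge0// sumr_ge0// => k _.
    by rewrite mulr_ge0//; apply: (excess_ge0 beta_ge0 beta_lt1 w_bounded).
  - rewrite big1 ?mulr0 ?addr0 /M ?lerDl// => k _.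
    rewrite (excess_eq0 _ w_noninc) ?mulr0//.
    exact: le_trans (ler_norm _) (w_bounded _ _).
have [Gamma GammaP] := @threshold_of_noninc _ _ w c w_noninc.
exists Gamma.
have beta1 : 1 - beta != 0 by rewrite subr_eq0 eq_sym lt_eqF.
pose A := c / (1 - beta).
have AE : c = A - beta * A by rewrite /A; field.
pose V s := A + excess beta w c s.
have active s : action_value P ps r1 r0 W beta V s true = A.
  rewrite /action_value /slot_reward /= subrr mulr0 addr0.
  under eq_bigr do rewrite mulrDr.
  by rewrite big_split /= -mulr_suml ps_sum; move: cE; rewrite {2}AE; lra.
(* Being passive gains w - c now, where V counts only its positive part. *)
have passive s : (0 < s.2)%N -> action_value P ps r1 r0 W beta V s false =
    V s + (w s - c) - Num.max (w s - c) 0.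
  move=> s0; rewrite /action_value /slot_reward /= subr0 mulr1 -/(w s) /V.
  rewrite (excessS beta_ge0 beta_lt1 w_bounded c s0).
  by move: AE; lra.
apply: (@optimal_of_bellman _ _ _ _ _ _ _ _ V
  (`|A| + (1 - beta)^-1 * (M + `|c|))) => //.
- move=> s s0; apply: (le_trans (ler_normD _ _)); rewrite lerD2l.
  rewrite ger0_norm ?(excess_ge0 beta_ge0 beta_lt1 w_bounded)//.
  exact: (excess_le beta_ge0 beta_lt1 w_bounded).
- move=> s [|] s0; rewrite ?active ?passive//.
    by rewrite lerDl (excess_ge0 beta_ge0 beta_lt1 w_bounded).
  by rewrite -addrA gerDl subr_le0 le_max lexx.
- move=> h s a s0; rewrite /action_prob /= GammaP//.
  case: leP => wc; case: a => //=; rewrite ?subrr ?eqxx// => _.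
    by rewrite active /V (excess_eq0 _ w_noninc) ?addr0.
  by rewrite passive// max_l ?addrK// subr_ge0 ltW.
Qed.
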